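(* Let $$U_3=\mathrm{Tof}_{1,6,7}\,\mathrm{Tof}_{2,5,7}\,\mathrm{Tof}_{3,4,7}\,\mathrm{Tof}_{2,4,6}\,\mathrm{Tof}_{1,4,5}\,\mathrm{Tof}_{1,2,3},$$ $$G=\mathrm{CSWAP}_{7,1,6}\,\mathrm{CSWAP}_{7,2,5}\,\mathrm{CSWAP}_{7,4,3}\cdot\mathrm{CCZ}_{1,2,3}\,\mathrm{CCZ}_{1,4,5}\,\mathrm{CCZ}_{2,4,6}\,\mathrm{CCZ}_{3,5,6},$$ $$F=H_3H_5H_6\,\mathrm{CNOT}_{6,1}\,\mathrm{CNOT}_{5,2}\,\mathrm{CNOT}_{3,4}\,H_7,$$ regarded as gates on $7$ qubits. Then $U_3$ is a permutation gate in $\mathcal{C}_3$ on $7$ qubits that is not semi-Clifford, and $FGF^{-1}=U_3$.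
   Context: Gates on $n$ qubits are unitary operators on $(\mathbb{C}^2)^{\otimes n}$, with computational basis $\{|v\rangle : v\in\mathbb{F}_2^n\}$; products are operator products (rightmost factor applied first). The Pauli group $\mathcal{P}_n$ consists of all $cP_1\otimes\cdots\otimes P_n$ with $c\in\{\pm1,\pm i\}$ and $P_j\in\{I_2,X,Y,Z\}$. The Clifford hierarchy: $\mathcal{C}_1=\mathcal{P}_n$, and for $k\ge2$, $\mathcal{C}_k$ is the set of unitaries $U$ with $UPU^\dagger\in\mathcal{C}_{k-1}$ for all $P\in\mathcal{P}_n$. $\mathcal{C}_2$ is the Clifford group. A permutation gate is a unitary whose matrix in the computational basis is a permutation matrix. A gate is semi-Clifford if it equals $\phi_1d\phi_2$ for some Clifford gates $\phi_1,\phi_2$ and some gate $d$ diagonal in the computational basis. Subscripts indicate the qubits acted on. $H=\frac1{\sqrt2}\begin{bmatrix}1&1\\1&-1\end{bmatrix}$. $\mathrm{CNOT}_{i,j}$ replaces $a_j$ by $a_j+a_i$. $\mathrm{Tof}_{i,j,k}$ replaces $a_k$ by $a_k+a_ia_j$. $\mathrm{CSWAP}_{i,j,k}$ swaps $a_j$ and $a_k$ if $a_i=1$ and does nothing if $a_i=0$. $\mathrm{CCZ}_{i,j,k}$ multiplies $|a\rangle$ by $(-1)^{a_ia_ja_k}$. *)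

(* Defs.v *)
From mathcomp Require Import all_boot all_order all_algebra.

Set Implicit Arguments.
Unset Strict Implicit.
Unset Printing Implicit Defensive.

Import Order.TTheory GRing.Theory Num.Theory.
Local Open Scope ring_scope.
Local Open Scope sesquilinear_scope.

(* Computational basis labels: F_2^n.  Row vectors, so a_i is [a 0 i]. *)
Notation bits n := 'rV['F_2]_n.

(* Operators on (C^2)^{\otimes n} as matrices in the computational basis: the
   index set of the matrix is the enumeration of F_2^n.  Operators act on
   column vectors, so in [A *m B] the factor B is applied first. *)
Notation operator C n := 'M[C]_#|{: bits n}|.

Section Gates.

Variable C : numClosedFieldType.

(* The operator with entries <w| U |v> = f w v. *)
Definition op_of (n : nat) (f : bits n -> bits n -> C) : operator C n :=
  \matrix_(i, j) f (enum_val i) (enum_val j).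

(* The operator |v> |-> |f v>. *)
Definition op_of_map (n : nat) (f : bits n -> bits n) : operator C n :=
  op_of (fun w v => (w == f v)%:R).

(* P_1 \otimes ... \otimes P_n.  A bit, an element of 'F_2, is used as the
   index of a row or column of a 2 x 2 matrix, 'F_2 being convertible to 'I_2. *)
Definition tensor (n : nat) (P : 'I_n -> 'M[C]_2) : operator C n :=
  op_of (fun w v => \prod_(i < n) P i (w 0 i) (v 0 i)).

Definition mx2 (a b c d : C) : 'M[C]_2 :=
  \matrix_(i, j) if i == 0 then (if j == 0 then a else b)
                 else (if j == 0 then c else d).

Definition pauliX : 'M[C]_2 := mx2 0 1 1 0.
Definition pauliY : 'M[C]_2 := mx2 0 (- 'i) 'i 0.
Definition pauliZ : 'M[C]_2 := mx2 1 0 0 (- 1).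
Definition hadamard : 'M[C]_2 := (sqrtC 2)^-1 *: mx2 1 1 1 (- 1).

Definition pauli_group (n : nat) (U : operator C n) : Prop :=
  exists (c : C) (P : 'I_n -> 'M[C]_2),
    [/\ c \in [:: 1; - 1; 'i; - 'i],
        forall j, P j \in [:: 1%:M; pauliX; pauliY; pauliZ]
      & U = c *: tensor P].

(* C_k.  The hierarchy starts at k = 1; C_0 is set to be empty. *)
Fixpoint clifford_hierarchy (n k : nat) (U : operator C n) {struct k} : Prop :=
  match k with
  | 0 => False
  | k'.+1 =>
    match k' with
    | 0 => pauli_group U
    | _.+1 => U \is unitarymx /\
        forall P : operator C n, pauli_group P ->
          clifford_hierarchy k' (U *m P *m U^t*)
    end
  end.

Definition clifford (n : nat) (U : operator C n) : Prop :=
  clifford_hierarchy 2 U.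

Definition permutation_gate (n : nat) (U : operator C n) : Prop :=
  U \is unitarymx /\ is_perm_mx U.

Definition semi_clifford (n : nat) (U : operator C n) : Prop :=
  exists phi1 d phi2 : operator C n,
    [/\ clifford phi1, clifford phi2, d \is unitarymx /\ is_diag_mx d
      & U = phi1 *m d *m phi2].

(* Replace the bit a_k by b. *)
Definition set_bit (n : nat) (a : bits n) (k : 'I_n) (b : 'F_2) : bits n :=
  \row_l (if l == k then b else a 0 l).

Definition H (n : nat) (i : 'I_n) : operator C n :=
  tensor (fun l => if l == i then hadamard else 1%:M).

Definition CNOT (n : nat) (i j : 'I_n) : operator C n :=
  op_of_map (fun a => set_bit a j (a 0 j + a 0 i)).

Definition Tof (n : nat) (i j k : 'I_n) : operator C n :=
  op_of_map (fun a => set_bit a k (a 0 k + a 0 i * a 0 j)).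

Definition CSWAP (n : nat) (i j k : 'I_n) : operator C n :=
  op_of_map (fun a => if a 0 i == 1
                      then set_bit (set_bit a j (a 0 k)) k (a 0 j) else a).

(* The exponent is the product in 'F_2, seen as the natural number 0 or 1. *)
Definition CCZ (n : nat) (i j k : 'I_n) : operator C n :=
  op_of (fun w v =>
    (w == v)%:R * (- 1) ^+ nat_of_ord (v 0 i * v 0 j * v 0 k)).

(* Qubits are numbered from 1, ordinals from 0. *)
Notation "''q_' k" := (@Ordinal 7 k.-1 isT) (at level 8, k at level 2).

Definition U3 : operator C 7 :=
  Tof 'q_1 'q_6 'q_7 *m Tof 'q_2 'q_5 'q_7 *m Tof 'q_3 'q_4 'q_7 *m
  Tof 'q_2 'q_4 'q_6 *m Tof 'q_1 'q_4 'q_5 *m Tof 'q_1 'q_2 'q_3.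

Definition G : operator C 7 :=
  CSWAP 'q_7 'q_1 'q_6 *m CSWAP 'q_7 'q_2 'q_5 *m CSWAP 'q_7 'q_4 'q_3 *m
  (CCZ 'q_1 'q_2 'q_3 *m CCZ 'q_1 'q_4 'q_5 *m
   CCZ 'q_2 'q_4 'q_6 *m CCZ 'q_3 'q_5 'q_6).

Definition F : operator C 7 :=
  H 'q_3 *m H 'q_5 *m H 'q_6 *m
  CNOT 'q_6 'q_1 *m CNOT 'q_5 'q_2 *m CNOT 'q_3 'q_4 *m H 'q_7.

End Gates.

(* Main.v *)
Require Import Defs.
From mathcomp Require Import all_boot all_order all_fingroup all_algebra.
From mathcomp Require Import reals complex.
From Stdlib Require Import Ring.

Import GRing.Theory Num.Theory.
Local Open Scope ring_scope.

(* Write U3 |v> = |pi v>.  The permutation pi is cubic, but its inverse is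
   quadratic: the four cubic terms a1 a2 a4 produced by inverting pi cancel.
   Conjugating a Pauli operator X^s Z^t by U3 gives the operator
     |v> |-> (-1)^(t . pi^-1 v) |pi (pi^-1 v + s)>,
   whose underlying map is an affine involution and whose phase is quadratic;
   such an operator is Clifford, so U3 is in the third level.

   If U = phi1 d phi2 is semi-Clifford, then conjugation by phi2 permutes the
   Pauli operators modulo phases, and U conjugates to Pauli operators the 2^n
   preimages of the Z-type Paulis, since d commutes with the latter.  But U3
   conjugates X^s Z^t to a Pauli operator only if s is supported on qubit 7 and
   t on qubits 1, 2, 4, which leaves 2^4 < 2^7 possibilities.

   Finally F is a product of CNOTs followed by Hadamards on qubits 3, 5, 6, 7,
   hence has explicit matrix entries, and F G = U3 F is checked on entries; it
   reduces to a polynomial identity over F_2. *)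

Set Implicit Arguments.
Unset Strict Implicit.
Unset Printing Implicit Defensive.

Local Open Scope sesquilinear_scope.

(** * Arithmetic of F_2 and reflection of bit polynomials into a Boolean ring *)

Lemma F2P (x : 'F_2) : x = 0 \/ x = 1.
Proof. by case: x => [[|[|m]] lt_m] //; [left | right]; apply/val_inj. Qed.

Lemma addF2 (x : 'F_2) : x + x = 0.
Proof. by case: (F2P x) => ->; apply/val_inj. Qed.

Lemma oppF2 (x : 'F_2) : - x = x.
Proof. by apply/eqP; rewrite eq_sym -addr_eq0 addF2. Qed.

(* F_2 is identified with the Boolean ring (xorb, andb), over which [ring]
   computes coefficients modulo 2. *)
Add Ring bool_ring : BoolTheory (decidable bool_eq_ok).

Definition F2_of_bool (b : bool) : 'F_2 := b%:R.

Lemma F2_of_boolD b c : F2_of_bool (xorb b c) = F2_of_bool b + F2_of_bool c.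
Proof. by case: b c => [] []; apply/val_inj. Qed.

Lemma F2_of_boolM b c : F2_of_bool (andb b c) = F2_of_bool b * F2_of_bool c.
Proof. by case: b c => [] []; apply/val_inj. Qed.

Lemma F2_of_bool0 : 0 = F2_of_bool false. Proof. by []. Qed.
Lemma F2_of_bool1 : 1 = F2_of_bool true. Proof. by []. Qed.

Lemma addF2_of_bool x y b c :
  x = F2_of_bool b -> y = F2_of_bool c -> x + y = F2_of_bool (xorb b c).
Proof. by move=> -> ->; rewrite F2_of_boolD. Qed.

Lemma mulF2_of_bool x y b c :
  x = F2_of_bool b -> y = F2_of_bool c -> x * y = F2_of_bool (andb b c).
Proof. by move=> -> ->; rewrite F2_of_boolM. Qed.

Lemma F2_of_bool_eq x y b c :
  x = F2_of_bool b -> y = F2_of_bool c -> b = c -> x = y.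
Proof. by move=> -> -> ->. Qed.

Lemma F2_of_bool_eq1 x : x = F2_of_bool (x == 1).
Proof. by case: (F2P x) => ->. Qed.

Local Notation "''q_' k" := (@Ordinal 7 k.-1 isT) (at level 8, k at level 2).

Lemma eq_bits7 (u v : bits 7) :
  u 0 'q_1 = v 0 'q_1 -> u 0 'q_2 = v 0 'q_2 -> u 0 'q_3 = v 0 'q_3 ->
  u 0 'q_4 = v 0 'q_4 -> u 0 'q_5 = v 0 'q_5 -> u 0 'q_6 = v 0 'q_6 ->
  u 0 'q_7 = v 0 'q_7 -> u = v.
Proof.
move=> E1 E2 E3 E4 E5 E6 E7; apply/rowP => i.
have : i \in [:: 'q_1; 'q_2; 'q_3; 'q_4; 'q_5; 'q_6; 'q_7].
  by case: i => [[|[|[|[|[|[|[|m]]]]]]] lt_m].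
by rewrite !inE => /or4P[||| /or4P[]] /eqP ->.
Qed.

Definition row7 (x1 x2 x3 x4 x5 x6 x7 : 'F_2) : bits 7 :=
  \row_i nth 0 [:: x1; x2; x3; x4; x5; x6; x7] i.

Section Coordinates.

Variables (n : nat) (i k : 'I_n) (x : 'F_2) (b : bool).
Implicit Types u v : bits n.

(** The coordinate lemmas keep a free right side so that [F2_quote] can apply them while that side
    is still an existential variable. *)
Lemma row7_coord x1 x2 x3 x4 x5 x6 x7 (j : 'I_7) :
  nth 0 [:: x1; x2; x3; x4; x5; x6; x7] j = x ->
  row7 x1 x2 x3 x4 x5 x6 x7 0 j = x.
Proof. by rewrite mxE. Qed.

Lemma add_coord u v : u 0 i + v 0 i = x -> (u + v) 0 i = x.
Proof. by rewrite mxE. Qed.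

Lemma zero_coord : 0 = x -> (0 : bits n) 0 i = x.
Proof. by rewrite mxE. Qed.

Lemma set_bit_coord_eq u y : i == k -> y = x -> set_bit u k y 0 i = x.
Proof. by rewrite mxE => ->. Qed.

Lemma set_bit_coord_neq u y : i != k -> u 0 i = x -> set_bit u k y 0 i = x.
Proof. by rewrite mxE => /negPf ->. Qed.

Lemma delta_coord : (i == k) = b -> (delta_mx 0 k : bits n) 0 i = F2_of_bool b.
Proof. by rewrite mxE eqxx => ->. Qed.

End Coordinates.

(** On a goal [e = F2_of_bool ?b], builds [?b] by recursion on [e]: coordinates are pushed through
    vector constructors, index tests are decided by computation, and an atom [x] becomes the Boolean
    [x == 1]. *)
Ltac F2_quote :=
  lazymatch goal with
  | |- (_ + _)%R = _ => apply: addF2_of_bool; F2_quote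
  | |- (_ * _)%R = _ => apply: mulF2_of_bool; F2_quote
  | |- 0%R = _ => exact: F2_of_bool0
  | |- 1%R = _ => exact: F2_of_bool1
  | |- fun_of_matrix (row7 _ _ _ _ _ _ _) _ _ = _ =>
      apply: row7_coord; simpl nth; F2_quote
  | |- fun_of_matrix (_ + _)%R _ _ = _ => apply: add_coord; F2_quote
  | |- fun_of_matrix 0%R _ _ = _ => apply: zero_coord; F2_quote
  | |- fun_of_matrix (set_bit _ ?k _) _ ?i = _ =>
      lazymatch eval vm_compute in (i == k) with
      | true => apply: set_bit_coord_eq; [by [] | F2_quote]
      | false => apply: set_bit_coord_neq; [by [] | F2_quote]
      end
  | |- fun_of_matrix (delta_mx _ ?k) _ ?i = _ =>
      let b := eval vm_compute in (i == k) in
      apply: (delta_coord (b := b)); exact: erefl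
  | |- _ => simpl; exact: F2_of_bool_eq1
  end.

Ltac F2_ring := apply: F2_of_bool_eq; [F2_quote | F2_quote | ring].

Lemma add_bits n (v : bits n) : v + v = 0.
Proof. by apply/rowP => i; rewrite !mxE addF2. Qed.

(** * Operators in the computational basis *)

Section Operators.

Variables (C : numClosedFieldType) (n : nat).
Implicit Types (f g : bits n -> bits n -> C) (s t u v w : bits n).
Implicit Types (h k : bits n -> bits n) (p q : bits n -> C).

Lemma op_of_ext f g : f =2 g -> op_of f = op_of g.
Proof. by move=> fg; apply/matrixP=> i j; rewrite !mxE fg. Qed.

Lemma op_of_inj f g : op_of f = op_of g -> f =2 g.
Proof.
move=> /matrixP fg w v; have := fg (enum_rank w) (enum_rank v).
by rewrite !mxE !enum_rankK.
Qed.

Lemma mul_op_of f g :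
  op_of f *m op_of g = op_of (fun w v => \sum_u f w u * g u v).
Proof.
apply/matrixP=> i j; rewrite !mxE.
rewrite [RHS](reindex_omap enum_val (fun x => Some (enum_rank x))) /=.
  by apply: eq_big => [k|k _]; rewrite ?enum_valK ?eqxx ?mxE.
by move=> x _; rewrite enum_rankK.
Qed.

Lemma op_of_1 : op_of (fun w v : bits n => (w == v)%:R) = 1%:M :> operator C n.
Proof. by apply/matrixP=> i j; rewrite !mxE (inj_eq enum_val_inj). Qed.

Lemma adj_op_of f : (op_of f)^t* = op_of (fun w v => (f v w)^*).
Proof. by apply/matrixP=> i j; rewrite !mxE. Qed.

(** The operator taking |v> to p(v)|h v>. Permutation gates, diagonal gates, Pauli operators and [G]
    all have this form, which is stable under products and, for bijective [h], adjoints. *)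
Definition monomial h p : operator C n := op_of (fun w v => (w == h v)%:R * p v).

Lemma mul_op_of_monomial f h p :
  op_of f *m monomial h p = op_of (fun w v => f w (h v) * p v).
Proof.
rewrite mul_op_of; apply: op_of_ext => w v.
rewrite (bigD1 (h v)) //= eqxx mul1r big1 ?addr0 // => u /negPf->.
by rewrite mul0r mulr0.
Qed.

Lemma mul_monomial h p k q :
  monomial h p *m monomial k q = monomial (h \o k) (fun v => p (k v) * q v).
Proof. by rewrite mul_op_of_monomial; apply: op_of_ext => w v; rewrite -mulrA. Qed.

Lemma monomial_ext h p k q : h =1 k -> p =1 q -> monomial h p = monomial k q.
Proof. by move=> hk pq; apply: op_of_ext => w v; rewrite hk pq. Qed.

Lemma monomial_id1 : monomial id (fun=> 1) = 1%:M.
Proof. by rewrite -op_of_1; apply: op_of_ext => w v; rewrite mulr1. Qed.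

Lemma op_of_mapE h : op_of_map C h = monomial h (fun=> 1).
Proof. by apply: op_of_ext => w v; rewrite mulr1. Qed.

Lemma mul_op_of_map h k : op_of_map C h *m op_of_map C k = op_of_map C (h \o k).
Proof.
by rewrite !op_of_mapE mul_monomial; apply: monomial_ext => // v; rewrite mulr1.
Qed.

Lemma mul_op_of_map_op h k f : cancel h k -> cancel k h ->
  op_of_map C h *m op_of f = op_of (fun w v => f (k w) v).
Proof.
move=> hK kK; rewrite mul_op_of; apply: op_of_ext => w v.
rewrite (bigD1 (k w)) //= kK eqxx mul1r big1 ?addr0 // => u.
by case: (w =P h u) => [->|_ _]; rewrite ?hK ?eqxx ?mul0r.
Qed.

Lemma adj_monomial h k p : cancel h k -> cancel k h ->
  (monomial h p)^t* = monomial k (fun w => (p (k w))^*).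
Proof.
move=> hK kK; rewrite adj_op_of; apply: op_of_ext => w v.
rewrite rmorphM rmorph_nat eq_sym (can2_eq hK kK).
by case: eqP => [->|]; rewrite ?mul0r.
Qed.

Lemma unitary_monomial h k p : cancel h k -> cancel k h ->
  (forall v, p v * (p v)^* = 1) -> monomial h p \is unitarymx.
Proof.
move=> hK kK p1; apply/unitarymxP.
rewrite (adj_monomial _ hK kK) mul_monomial -monomial_id1.
by apply: monomial_ext => v /=.
Qed.

Lemma monomial_inj h p k q : (forall v, p v != 0) ->
  monomial h p = monomial k q -> h =1 k /\ p =1 q.
Proof.
move=> p0 /op_of_inj E.
have hk : h =1 k.
  move=> v; have := E (h v) v; rewrite eqxx mul1r.
  case: (h v =P k v) => // _; rewrite mul0r => /eqP; by rewrite (negPf (p0 v)).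
by split=> // v; have := E (h v) v; rewrite -hk !eqxx !mul1r.
Qed.

Lemma scale_monomial c h p : c *: monomial h p = monomial h (fun v => c * p v).
Proof. by apply/matrixP=> i j; rewrite !mxE mulrCA. Qed.

Lemma monomial_diag p : is_diag_mx (monomial id p).
Proof.
apply/is_diag_mxP => i j ij; rewrite mxE (inj_eq enum_val_inj).
by case: (i =P j) ij => [->|]; rewrite ?eqxx ?mul0r.
Qed.

Lemma op_of_map_perm h : injective h -> is_perm_mx (op_of_map C h).
Proof.
move=> hI; apply/is_perm_mxP.
have sI : injective (fun j : 'I_#|{: bits n}| => enum_rank (h (enum_val j))).
  by move=> i j /enum_rank_inj/hI/enum_val_inj.
(* A permutation matrix is indexed here from row to column, whereas [h] goes from column to row,
   hence the inverse. *)
exists (perm sI)^-1%g; apply/matrixP => i j; rewrite !mxE.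
rewrite (can2_eq (permKV _) (permK _)) permE -(can2_eq enum_valK enum_rankK) //.
Qed.

End Operators.

(** * Signs and linear forms on F_2^n *)

Section Sign.

Variables (C : numClosedFieldType) (n : nat).
Implicit Types (x y : 'F_2) (s t u v w : bits n).

Definition sgn x : C := (-1) ^+ x.

Lemma sgn0 : sgn 0 = 1. Proof. by []. Qed.
Lemma sgn1 : sgn 1 = -1. Proof. by []. Qed.

Lemma sgnD : {morph sgn : x y / x + y >-> x * y}.
Proof.
move=> x y; case: (F2P x) => ->; case: (F2P y) => ->;
  by rewrite ?addF2 ?addr0 ?add0r ?sgn1 ?sgn0 ?mulrNN ?mulr1 ?mul1r.
Qed.

Lemma sgn_sqr x : sgn x * sgn x = 1.
Proof. by rewrite -sgnD addF2. Qed.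

Lemma sgn_neq0 x : sgn x != 0.
Proof.
apply/eqP => x0; have := sgn_sqr x.
by rewrite x0 mul0r => /esym/eqP; rewrite oner_eq0.
Qed.

Lemma conj_sgn x : (sgn x)^* = sgn x.
Proof. by case: (F2P x) => ->; rewrite ?sgn1 ?rmorphN1 ?rmorph1. Qed.

Lemma sgn_inj : injective sgn.
Proof.
have N1 : (-1 == 1 :> C) = false by rewrite eqNr oner_eq0.
move=> x y; case: (F2P x) => ->; case: (F2P y) => -> //; rewrite sgn1 sgn0 => /eqP;
  by rewrite ?N1 // eq_sym N1.
Qed.

Definition dot t v : 'F_2 := \sum_j t 0 j * v 0 j.

Lemma dotDr s u v : dot s (u + v) = dot s u + dot s v.
Proof. by rewrite -big_split; apply: eq_bigr => j _; rewrite mxE mulrDr. Qed.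

Lemma dot0 t : dot t 0 = 0.
Proof. by rewrite /dot big1 // => j _; rewrite mxE mulr0. Qed.

Lemma dot_delta t j : dot t (delta_mx 0 j) = t 0 j.
Proof.
rewrite /dot (bigD1 j) //= mxE !eqxx mulr1 big1 ?addr0 // => i /negPf ij.
by rewrite mxE ij andbF mulr0.
Qed.

(** The only scalars of F_2 are 0 and 1, so additivity is linearity; [t] lists the values on the
    standard basis. *)
Lemma additive_dot (f : bits n -> 'F_2) :
  {morph f : u v / u + v} -> exists t, f =1 dot t.
Proof.
move=> fD; exists (\row_j f (delta_mx 0 j)) => v.
have f0 : f 0 = 0 by have := fD 0 0; rewrite addr0 => E; rewrite E addF2.
rewrite {1}[v]row_sum_delta (big_morph f fD f0); apply: eq_bigr => j _.
by rewrite mxE; case: (F2P (v 0 j)) => ->; rewrite ?scale0r ?scale1r ?mulr0 ?mulr1.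
Qed.

End Sign.

(** * Pauli operators and the Clifford hierarchy *)

Section Pauli.

Variables (C : numClosedFieldType) (n : nat).
Implicit Types (s t u v w : bits n) (c : C).

(** The operator X^s Z^t, with Z^t applied first. *)
Definition pauli s t : operator C n :=
  monomial (fun v => v + s) (fun v => sgn C (dot t v)).

Lemma root4P c : reflect (c ^+ 4 = 1) (c \in [:: 1; -1; 'i; - 'i]).
Proof.
have E : c ^+ 4 - 1 = (c - 1) * (c + 1) * ((c - 'i) * (c + 'i)).
  by rewrite -subr_sqr_1 -subr_sqr sqrCi opprK -subr_sqr_1 -exprM.
apply: (iffP idP) => [|/eqP].
  rewrite !inE -[c == 1]subr_eq0 -[c == -1]subr_eq0 -[c == 'i]subr_eq0.
  rewrite -[c == - 'i]subr_eq0 !opprK orbA -!mulf_eq0 -E subr_eq0; by move/eqP.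
by rewrite -subr_eq0 E !mulf_eq0 !subr_eq0 !addr_eq0 !inE !orbA.
Qed.

Lemma root4_norm c : c ^+ 4 = 1 -> c * c^* = 1.
Proof.
move=> c4; rewrite -normCK; have /eqP : `|c| ^+ 4 = 1 by rewrite -normrX c4 normr1.
by rewrite pexpr_eq1 // => /eqP ->; rewrite expr1n.
Qed.

(* [pauli_mx x y] is the scalar [pauli_phase x y] times X^x Z^y; in particular
   Y = i X Z. *)
Definition pauli_mx (x y : 'F_2) : 'M[C]_2 :=
  if x == 0 then if y == 0 then 1%:M else pauliZ C
  else if y == 0 then pauliX C else pauliY C.

Definition pauli_phase (x y : 'F_2) : C := if x * y == 0 then 1 else 'i.

Lemma pauli_mxE x y a b :
  pauli_mx x y a b = (a == b + x)%:R * (pauli_phase x y * sgn C (y * b)).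
Proof.
have E11 : 1 + 1 = 0 :> 'F_2 by rewrite addF2.
have E : (1 == 0 :> 'F_2) = false by [].
have E' : (0 == 1 :> 'F_2) = false by [].
rewrite /pauli_mx /pauli_phase.
case: (F2P x) => ->; case: (F2P y) => ->; case: (F2P a) => ->;
  case: (F2P b) => ->;
  rewrite ?mxE ?(E, E', eqxx, E11, mul0r, mulr0, mulr1, mul1r, addr0, add0r)
    ?(sgn0, sgn1) /= ?(mulrN1, mulr1) //.
Qed.

Lemma pauli_mxP (P : 'M[C]_2) :
  P \in [:: 1%:M; pauliX C; pauliY C; pauliZ C] -> exists xy, P = pauli_mx xy.1 xy.2.
Proof.
rewrite !inE => /or4P[] /eqP ->;
  [exists (0, 0) | exists (1, 0) | exists (1, 1) | exists (0, 1)]; by [].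
Qed.

Lemma pauli_mx_in x y :
  pauli_mx x y \in [:: 1%:M; pauliX C; pauliY C; pauliZ C].
Proof. by rewrite /pauli_mx; do 2![case: ifP => _]; rewrite !inE eqxx ?orbT. Qed.

Lemma prod_eq_bits w v : \prod_i (w 0 i == v 0 i)%:R = (w == v)%:R :> C.
Proof.
case: eqP => [->|/eqP wv]; first by rewrite big1 // => i _; rewrite eqxx.
have [i /negPf wvi] : exists i, w 0 i != v 0 i.
  apply/existsP; apply: contraR wv; rewrite negb_exists => /forallP wv.
  by apply/eqP/rowP => i; have := wv i; rewrite negbK => /eqP.
by rewrite (bigD1 i) //= wvi mul0r.
Qed.

Lemma tensor_pauli_mx s t :
  tensor (fun i => pauli_mx (s 0 i) (t 0 i)) =
  (\prod_i pauli_phase (s 0 i) (t 0 i)) *: pauli s t.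
Proof.
rewrite scale_monomial; apply: op_of_ext => w v.
rewrite (eq_bigr _ (fun i _ => pauli_mxE _ _ _ _)).
rewrite big_split /= big_split /= -prod_eq_bits; congr (_ * (_ * _)).
  by apply: eq_bigr => i _; rewrite mxE.
by rewrite /dot (big_morph _ (@sgnD C) (sgn0 C)).
Qed.

Lemma pauli_phase4 s t : (\prod_i pauli_phase (s 0 i) (t 0 i)) ^+ 4 = 1.
Proof.
rewrite -prodrXl big1 // => i _; rewrite /pauli_phase.
case: ifP => _; first exact: expr1n.
by rewrite (exprM _ 2 2) sqrCi sqrrN expr1n.
Qed.

(** Each tensor factor Y = i X Z contributes a phase i; as a fourth root of unity it is absorbed
    into [c], leaving a pair of bit vectors as label. *)
Lemma pauliP (U : operator C n) : pauli_group U <->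
  exists c s t, c ^+ 4 = 1 /\ U = c *: pauli s t.
Proof.
split=> [[c [P [/root4P c4 PP ->]]] | [c [s [t [c4 ->]]]]].
  have [xy Exy] := fin_all_exists (fun j => pauli_mxP (PP j)).
  set s : bits n := \row_j (xy j).1; set t : bits n := \row_j (xy j).2.
  exists (c * \prod_i pauli_phase (s 0 i) (t 0 i)), s, t.
  rewrite exprMn c4 mul1r pauli_phase4 -scalerA -tensor_pauli_mx; split=> //.
  congr (_ *: _); apply: op_of_ext => w v.
  by apply: eq_bigr => i _; rewrite Exy !mxE.
have p4 := pauli_phase4 s t; set d := \prod_i _ in p4.
have d0 : d != 0 by apply/eqP => d0; move/eqP: p4; rewrite d0 expr0n eq_sym oner_eq0.
exists (c / d), (fun i => pauli_mx (s 0 i) (t 0 i)); split.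
- by apply/root4P; rewrite expr_div_n c4 p4 divr1.
- by move=> j; apply: pauli_mx_in.
- by rewrite tensor_pauli_mx scalerA -/d divfK.
Qed.

(** The column of 0 determines the shift and the scalar; the phases on basis vectors then determine
    the Z part. *)
Lemma pauli_inj c c' s t s' t' : c != 0 ->
  c *: pauli s t = c' *: pauli s' t' -> [/\ c = c', s = s' & t = t'].
Proof.
move=> c0; rewrite !scale_monomial => /monomial_inj[v|].
  by rewrite mulf_neq0 ?sgn_neq0.
move=> Es Et; have Ec := Et 0; rewrite !dot0 !sgn0 !mulr1 in Ec.
split=> //; first by have := Es 0; rewrite !add0r.
apply/rowP => j; have := Et (delta_mx 0 j).
by rewrite -Ec => /(mulfI c0)/sgn_inj; rewrite !dot_delta.
Qed.

Lemma conj_monomial h k (p q : bits n -> C) s : cancel h k -> cancel k h ->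
  monomial h p *m monomial (fun v => v + s) q *m (monomial h p)^t* =
  monomial (fun v => h (k v + s)) (fun v => p (k v + s) * q (k v) * (p (k v))^*).
Proof.
move=> hK kK; rewrite (adj_monomial _ hK kK) !mul_monomial.
exact: monomial_ext.
Qed.

Definition affine (f : bits n -> 'F_2) :=
  forall u v, f (u + v) = f u + f v + f 0.

Lemma affine_dot f : affine f -> exists t, forall v, f v = f 0 + dot t v.
Proof.
move=> fA; have [|t Et] := @additive_dot n (fun v => f 0 + f v).
  by move=> u v /=; rewrite fA; F2_ring.
by exists t => v; rewrite -Et addrA addF2 add0r.
Qed.

(** Conjugating X^s Z^t gives the translation by [h s + h 0], since [h] is affine, with phase
    exponent the derivative of [g] in direction [s] plus a linear form, read through [k]. The
    hypothesis on [g] (it is quadratic) makes this exponent affine, so the result is a Pauli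
    operator up to sign. *)
Lemma clifford_monomial h k c (g : bits n -> 'F_2) :
  cancel h k -> cancel k h -> c * c^* = 1 ->
  (forall u v, h (u + v) = h u + h v + h 0) ->
  (forall s, affine (fun u => g (u + s) + g u)) ->
  clifford (monomial h (fun v => c * sgn C (g v))).
Proof.
move=> hK kK c1 hA gA.
have kA u v : k (u + v) = k u + k v + k 0.
  apply: (can_inj hK); rewrite kK !hA !kK.
  by rewrite addr0 -addrA add_bits addr0.
split.
  apply: unitary_monomial hK kK _ => v.
  by rewrite rmorphM /= conj_sgn mulrACA c1 sgn_sqr mul1r.
move=> P /pauliP[b [s [t [b4 ->]]]].
have fA : affine (fun v => g (k v + s) + g (k v) + dot t (k v)).
  move=> u v; rewrite kA !dotDr.
  have /= -> := gA s (k u + k v) (k 0); have /= -> := gA s (k u) (k v).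
  F2_ring.
have [t' Et'] := affine_dot fA.
apply/pauliP; rewrite /= in Et'.
set f0 := (g (k 0 + s) + g (k 0) + dot t (k 0)) in Et'.
exists (b * sgn C f0), (h s + h 0), t'; split.
  by rewrite exprMn b4 mul1r (exprM _ 2 2) [sgn _ _ ^+ 2]expr2 sgn_sqr expr1n.
rewrite !scale_monomial (conj_monomial _ _ _ hK kK); apply: monomial_ext => v.
  by rewrite hA kK addrA.
rewrite rmorphM /= conj_sgn -[RHS]mulrA -sgnD -Et' !sgnD.
by rewrite [c * _ * _]mulrACA (mulrACA (c * b)) (mulrAC c) c1 mul1r
  (mulrAC (sgn _ _)).
Qed.

(** Retains only what a counting argument needs: at least 2^n Pauli labels whose conjugates by [U]
    are Pauli. *)
Lemma semi_clifford_pauli (U : operator C n) : semi_clifford U ->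
  exists q : bits n -> bits n * bits n, injective q /\
    forall b, pauli_group (U *m pauli (q b).1 (q b).2 *m U^t*).
Proof.
move=> [phi1 [d [phi2 [[phi1U phi1P] [phi2U phi2P] [dU dD] ->]]]].
have pg s t : pauli_group (pauli s t).
  by apply/pauliP; exists 1, s, t; rewrite expr1n scale1r.
have conjE x : exists y, exists c, c != 0 /\
    phi2 *m pauli x.1 x.2 *m phi2^t* = c *: pauli y.1 y.2.
  have /pauliP[c [s [t [c4 E]]]] := phi2P _ (pg x.1 x.2).
  exists (s, t), c; split=> //.
  by apply/eqP => c0; move/eqP: c4; rewrite c0 expr0n eq_sym oner_eq0.
have [f fP] := fin_all_exists conjE.
have adjK (V : operator C n) : V \is unitarymx -> V^t* *m V = 1%:M.
  by move=> /unitarymxP/mulmx1C.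
(* Conjugation by [phi2] can be undone, so two labels with the same image have proportional Pauli
   operators and are equal. *)
have fI : injective f.
  move=> x y fxy; have [c [c0 Ec]] := fP x; have [c' [c'0 Ec']] := fP y.
  have E : c' *: pauli x.1 x.2 = c *: pauli y.1 y.2.
    have K P : P = phi2^t* *m (phi2 *m P *m phi2^t*) *m phi2.
      by rewrite !mulmxA adjK // mul1mx -mulmxA adjK // mulmx1.
    rewrite [pauli x.1 _]K [pauli y.1 _]K Ec Ec' fxy.
    by rewrite -!(scalemxAr, scalemxAl) !scalerA mulrC.
  have [_] := pauli_inj c'0 E; case: (x) (y) => [x1 x2] [y1 y2] /= -> -> //.
(* The label (0, b) is that of Z^b, so [q b] labels the Pauli operator that [phi2] conjugates to a
   multiple of Z^b. *)
exists (fun b => invF fI (0, b)); split.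
  by move=> b b' /(can_inj (f_invF fI)) [].
move=> b; have [c [c0]] := fP (invF fI (0, b)).
rewrite f_invF /=; set P := pauli _ _ => E.
have dZ : d *m pauli 0 b = pauli 0 b *m d.
  have [D ->] := diag_mxP _ dD.
  have /diag_mxP[Z ->] : is_diag_mx (pauli 0 b).
    rewrite -(_ : monomial id (fun v => sgn C (dot b v)) = pauli 0 b)
      ?monomial_diag //.
    by apply: monomial_ext => // v; rewrite addr0.
  exact: diag_mxC.
have -> : phi1 *m d *m phi2 *m P *m (phi1 *m d *m phi2)^t* =
    phi1 *m (d *m (phi2 *m P *m phi2^t*) *m d^t*) *m phi1^t*.
  by rewrite !trmx_mul !map_mxM !mulmxA.
rewrite E -scalemxAr dZ -scalemxAl -[_ *m d *m _]mulmxA (unitarymxP _) // mulmx1.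
(* Here [c] is only known to be nonzero; rewriting back to the conjugate by [phi2] shows that the
   scaled operator is Pauli. *)
apply: phi1P; rewrite -E; exact: (phi2P _ (pg _ _)).
Qed.

End Pauli.

(** * The gate U3 *)

Definition U3_map (a : bits 7) : bits 7 :=
  row7 (a 0 'q_1) (a 0 'q_2) (a 0 'q_3 + a 0 'q_1 * a 0 'q_2) (a 0 'q_4)
    (a 0 'q_5 + a 0 'q_1 * a 0 'q_4) (a 0 'q_6 + a 0 'q_2 * a 0 'q_4)
    (a 0 'q_7 + a 0 'q_3 * a 0 'q_4 + a 0 'q_2 * a 0 'q_5 + a 0 'q_1 * a 0 'q_6
     + a 0 'q_1 * a 0 'q_2 * a 0 'q_4).

Definition U3_inv (a : bits 7) : bits 7 :=
  row7 (a 0 'q_1) (a 0 'q_2) (a 0 'q_3 + a 0 'q_1 * a 0 'q_2) (a 0 'q_4)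
    (a 0 'q_5 + a 0 'q_1 * a 0 'q_4) (a 0 'q_6 + a 0 'q_2 * a 0 'q_4)
    (a 0 'q_7 + a 0 'q_3 * a 0 'q_4 + a 0 'q_2 * a 0 'q_5 + a 0 'q_1 * a 0 'q_6).

(* The expansion of [U3_map (U3_inv v + s)], in which the terms quadratic in v
   cancel. *)
Definition U3_conj (s v : bits 7) : bits 7 :=
  v + U3_map s +
  row7 0 0 (s 0 'q_1 * v 0 'q_2 + s 0 'q_2 * v 0 'q_1) 0
    (s 0 'q_1 * v 0 'q_4 + s 0 'q_4 * v 0 'q_1)
    (s 0 'q_2 * v 0 'q_4 + s 0 'q_4 * v 0 'q_2)
    (s 0 'q_3 * v 0 'q_4 + s 0 'q_4 * v 0 'q_3 +
     s 0 'q_2 * v 0 'q_5 + s 0 'q_5 * v 0 'q_2 +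
     s 0 'q_1 * v 0 'q_6 + s 0 'q_6 * v 0 'q_1 +
     s 0 'q_1 * s 0 'q_2 * v 0 'q_4 + s 0 'q_1 * s 0 'q_4 * v 0 'q_2 +
     s 0 'q_2 * s 0 'q_4 * v 0 'q_1).

Definition cnots (a : bits 7) : bits 7 :=
  row7 (a 0 'q_1 + a 0 'q_6) (a 0 'q_2 + a 0 'q_5) (a 0 'q_3) (a 0 'q_4 + a 0 'q_3)
    (a 0 'q_5) (a 0 'q_6) (a 0 'q_7).

Definition G_map (a : bits 7) : bits 7 :=
  row7 (a 0 'q_1 + a 0 'q_7 * (a 0 'q_1 + a 0 'q_6))
       (a 0 'q_2 + a 0 'q_7 * (a 0 'q_2 + a 0 'q_5))
       (a 0 'q_3 + a 0 'q_7 * (a 0 'q_3 + a 0 'q_4))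
       (a 0 'q_4 + a 0 'q_7 * (a 0 'q_3 + a 0 'q_4))
       (a 0 'q_5 + a 0 'q_7 * (a 0 'q_2 + a 0 'q_5))
       (a 0 'q_6 + a 0 'q_7 * (a 0 'q_1 + a 0 'q_6)) (a 0 'q_7).

Ltac bits_ring := rewrite /U3_conj /U3_map /U3_inv /cnots /G_map; F2_ring.
Ltac bits7 := apply: eq_bits7; bits_ring.

Lemma U3_mapK : cancel U3_map U3_inv.
Proof. by move=> a; bits7. Qed.

Lemma U3_invK : cancel U3_inv U3_map.
Proof. by move=> a; bits7. Qed.

(** Derivatives of a quadratic map are affine; this supplies the phase hypothesis of
    [clifford_monomial], as [U3_conj_affine] supplies the one on the basis map. *)
Lemma U3_inv_quadratic s u v :
  U3_inv (u + v + s) + U3_inv (u + v) =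
  (U3_inv (u + s) + U3_inv u) + (U3_inv (v + s) + U3_inv v) +
  (U3_inv (0 + s) + U3_inv 0).
Proof. by bits7. Qed.

Lemma U3_conjE s v : U3_map (U3_inv v + s) = U3_conj s v.
Proof. by bits7. Qed.

Lemma U3_conj_affine s u v :
  U3_conj s (u + v) = U3_conj s u + U3_conj s v + U3_conj s 0.
Proof. by bits7. Qed.

(** * [U3] lies in the third level and is not semi-Clifford *)

Section ThirdLevel.

Variable C : numClosedFieldType.

Lemma U3E : U3 C = op_of_map C U3_map.
Proof.
rewrite /U3 /Tof !mul_op_of_map !op_of_mapE; apply: monomial_ext => // a /=.
by bits7.
Qed.

Lemma U3_conj_pauli s t :
  U3 C *m pauli C s t *m (U3 C)^t* =
  monomial (fun v => U3_map (U3_inv v + s)) (fun v => sgn C (dot t (U3_inv v))).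
Proof.
rewrite U3E op_of_mapE (conj_monomial _ _ _ U3_mapK U3_invK).
by apply: monomial_ext => // v; rewrite rmorph1 mulr1 mul1r.
Qed.

Lemma U3_permutation_gate : permutation_gate (U3 C).
Proof.
rewrite U3E; split; last exact: op_of_map_perm (can_inj U3_mapK).
rewrite op_of_mapE; apply: unitary_monomial U3_mapK U3_invK _ => v.
by rewrite rmorph1 mulr1.
Qed.

Lemma U3_third_level : clifford_hierarchy 3 (U3 C).
Proof.
split; first by have [] := U3_permutation_gate.
move=> P /pauliP[c [s [t [c4 ->]]]].
rewrite -scalemxAr -scalemxAl U3_conj_pauli scale_monomial.
pose h v := U3_map (U3_inv v + s).
(* [h] is conjugate to the translation by [s], an involution in characteristic 2. *)
have hK : cancel h h by move=> v; rewrite /h U3_mapK -addrA add_bits addr0 U3_invK.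
apply: (clifford_monomial (g := fun v => dot t (U3_inv v)) hK hK (root4_norm c4)).
  by move=> u v; rewrite /h !U3_conjE U3_conj_affine.
by move=> s' u v; rewrite -!dotDr U3_inv_quadratic.
Qed.

(** For a Pauli conjugate the basis map must be a translation and the phase exponent linear. The
    first condition tests [s] against the nonlinear terms of [U3_map], the second tests [t] against
    those of [U3_inv]. *)
Lemma U3_conj_pauliP s t : pauli_group (U3 C *m pauli C s t *m (U3 C)^t*) ->
  s = row7 0 0 0 0 0 0 (s 0 'q_7) /\
  t = row7 (t 0 'q_1) (t 0 'q_2) 0 (t 0 'q_4) 0 0 0.
Proof.
rewrite U3_conj_pauli => /pauliP[c [s' [t' [_]]]].
rewrite scale_monomial => /monomial_inj[v|Es Et]; first exact: sgn_neq0.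
have map0 : U3_map 0 = 0 by bits7.
have inv0 : U3_inv 0 = 0 by bits7.
(* The translation vector is read off at [U3_map x] and at 0, and the two values are compared. *)
have mapD x k : (U3_map (x + s) + U3_map x + U3_map s) 0 k = 0.
  have := Es (U3_map x); have := Es 0.
  rewrite inv0 !add0r U3_mapK => <- ->.
  by rewrite (addrAC (U3_map x)) add_bits add0r add_bits mxE.
have c1 : c = 1 by have := Et 0; rewrite inv0 !dot0 !sgn0 mulr1.
have invE v : dot t (U3_inv v) = dot t' v.
  by apply: (@sgn_inj C); rewrite Et c1 mul1r.
(* The left sum is the polar form of the quadratic map [U3_inv]; a linear exponent annihilates
   it. *)
have invD u v k : U3_inv (u + v) + U3_inv u + U3_inv v = delta_mx 0 k -> t 0 k = 0.
  move=> E; rewrite -dot_delta -E !dotDr !invE dotDr; bits_ring.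
have s1 : s 0 'q_1 = 0 by rewrite -(mapD (delta_mx 0 'q_2) 'q_3); bits_ring.
have s2 : s 0 'q_2 = 0 by rewrite -(mapD (delta_mx 0 'q_1) 'q_3); bits_ring.
have s4 : s 0 'q_4 = 0 by rewrite -(mapD (delta_mx 0 'q_1) 'q_5); bits_ring.
(* In coordinate 7 the cubic term of [U3_map] leaves products of two bits of [s], which vanish by
   [s1] and [s2]. *)
have s3 : s 0 'q_3 + s 0 'q_1 * s 0 'q_2 = 0.
  by rewrite -(mapD (delta_mx 0 'q_4) 'q_7); bits_ring.
have s5 : s 0 'q_5 + s 0 'q_1 * s 0 'q_4 = 0.
  by rewrite -(mapD (delta_mx 0 'q_2) 'q_7); bits_ring.
have s6 : s 0 'q_6 + s 0 'q_2 * s 0 'q_4 = 0.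
  by rewrite -(mapD (delta_mx 0 'q_1) 'q_7); bits_ring.
move: s3 s5 s6; rewrite s1 s2 !mul0r !addr0 => s3 s5 s6.
split; apply: eq_bits7; rewrite [RHS]mxE //=.
(* The pairs come from the monomials a1 a2, a1 a4, a2 a4, a3 a4 of [U3_inv], found in coordinates 3,
   5, 6, 7. *)
- apply: (invD (delta_mx 0 'q_1) (delta_mx 0 'q_2)); bits7.
- apply: (invD (delta_mx 0 'q_1) (delta_mx 0 'q_4)); bits7.
- apply: (invD (delta_mx 0 'q_2) (delta_mx 0 'q_4)); bits7.
- apply: (invD (delta_mx 0 'q_3) (delta_mx 0 'q_4)); bits7.
Qed.

Lemma U3_not_semi_clifford : ~ semi_clifford (U3 C).
Proof.
move=> /semi_clifford_pauli[q [qI qP]].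
(* These four bits determine [q b] by [U3_conj_pauliP], so [r] would embed 2^7 elements into 2^4. *)
pose r b := ((q b).1 0 'q_7, (q b).2 0 'q_1, (q b).2 0 'q_2, (q b).2 0 'q_4).
have /leq_card : injective r.
  move=> b b' [e7 e1 e2 e4]; apply: qI.
  have [Es Et] := U3_conj_pauliP (qP b); have [Es' Et'] := U3_conj_pauliP (qP b').
  by rewrite [q b]surjective_pairing Es Et e7 e1 e2 e4 -Es' -Et' -surjective_pairing.
by rewrite !card_prod card_mx !card_ord.
Qed.

End ThirdLevel.

(** * Conjugation of G by F *)

Section Tensor.

Variables (C : numClosedFieldType) (n : nat).

(** Expanding the product over qubits of the sums over one bit gives a sum over functions from
    qubits to bits, that is, over basis labels. *)
Lemma mul_tensor (P Q : 'I_n -> 'M[C]_2) :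
  tensor P *m tensor Q = tensor (fun i => P i *m Q i).
Proof.
rewrite mul_op_of; apply: op_of_ext => w v.
under [RHS]eq_bigr => i _ do rewrite mxE.
rewrite bigA_distr_bigA /=.
rewrite (reindex_onto (fun f : {ffun 'I_n -> 'F_2} => \row_i f i)
                      (fun u : bits n => [ffun i => u 0 i])) /=.
  apply: eq_big => [f|f _].
    by apply/eqP/ffunP => i; rewrite ffunE mxE.
  by rewrite -big_split; apply: eq_bigr => i _; rewrite !mxE.
by move=> u _; apply/rowP => i; rewrite !mxE ffunE.
Qed.

Lemma tensor1 : tensor (fun i : 'I_n => 1%:M) = 1%:M :> operator C n.
Proof.
rewrite -op_of_1; apply: op_of_ext => w v.
by rewrite -prod_eq_bits; apply: eq_bigr => i _; rewrite mxE.
Qed.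

Lemma hadamardE a b : hadamard C a b = (sqrtC 2)^-1 * sgn C (a * b).
Proof.
by rewrite !mxE; case: (F2P a) => ->; case: (F2P b) => ->; rewrite /= ?mulr1 ?mulr0.
Qed.

Lemma hadamard_sqr : hadamard C *m hadamard C = 1%:M.
Proof.
have r2 : (sqrtC 2)^-1 * (sqrtC 2)^-1 = 2^-1 :> C by rewrite -invfM -expr2 sqrtCK.
have E a b c : hadamard C a b * hadamard C b c = 2^-1 * sgn C (a * b + b * c).
  by rewrite !hadamardE mulrACA r2 sgnD.
apply/matrixP => a b; rewrite mxE !big_ord_recl big_ord0 addr0.
have -> : lift ord0 ord0 = 1 :> 'F_2 by apply: val_inj.
have -> : ord0 = 0 :> 'F_2 by apply: val_inj.
rewrite !E mulr0 mul0r addr0 sgn0 [a * 1]mulr1 [1 * b]mul1r -mulrDr mxE.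
case: (F2P a) => ->; case: (F2P b) => ->;
  rewrite ?addF2 ?addr0 ?add0r ?sgn0 ?sgn1 ?subrr ?mulr0 //=;
  by rewrite mulVf // pnatr_eq0.
Qed.

Lemma tensor_hadamard_sqr (D : pred 'I_n) :
  tensor (fun i => if D i then hadamard C else 1%:M) *m
  tensor (fun i => if D i then hadamard C else 1%:M) = 1%:M.
Proof.
rewrite mul_tensor -tensor1; apply: op_of_ext => w v; apply: eq_bigr => i _.
by case: (D i); rewrite ?hadamard_sqr ?mulmx1.
Qed.

End Tensor.

Section Conjugation.

Variable C : numClosedFieldType.

Lemma cnotsK : involutive cnots.
Proof. by move=> a; bits7. Qed.

Definition hadamards : operator C 7 :=
  tensor (fun i => if i \in [:: 'q_3; 'q_5; 'q_6; 'q_7] then hadamard C else 1%:M).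

Lemma prod_ord7 (f : 'I_7 -> C) :
  \prod_i f i = f 'q_1 * f 'q_2 * f 'q_3 * f 'q_4 * f 'q_5 * f 'q_6 * f 'q_7.
Proof.
rewrite !big_ord_recl big_ord0 mulr1 !mulrA.
by do 6?congr (_ * _); congr f; apply: val_inj.
Qed.

Lemma eqD_F2 (x y z : 'F_2) : (x + y == z) = (x == z + y).
Proof. by rewrite -{1}(oppF2 y) subr_eq. Qed.

Lemma FE : F C = hadamards *m op_of_map C cnots.
Proof.
(* The CNOTs do not touch qubit 7, so the last Hadamard moves to the left of them. *)
have HC : op_of_map C cnots *m H C 'q_7 = H C 'q_7 *m op_of_map C cnots.
  rewrite (mul_op_of_map_op _ cnotsK cnotsK) op_of_mapE mul_op_of_monomial.
  apply: op_of_ext => w v; rewrite mulr1 !prod_ord7 /= !mxE /= !eqD_F2.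
  (* Identity factors on the control qubits force [w] and [v] to agree there; adding the control bit
     to either side then gives the same test on the target. *)
  case: (w 0 'q_6 =P v 0 'q_6) => [->|_]; last by rewrite !(mulr0, mul0r).
  case: (w 0 'q_5 =P v 0 'q_5) => [->|_]; last by rewrite !(mulr0, mul0r).
  case: (w 0 'q_3 =P v 0 'q_3) => [->|_]; last by rewrite !(mulr0, mul0r).
  by [].
have cnotsE : CNOT C 'q_6 'q_1 *m CNOT C 'q_5 'q_2 *m CNOT C 'q_3 'q_4 =
    op_of_map C cnots.
  rewrite /CNOT !mul_op_of_map !op_of_mapE; apply: monomial_ext => // a /=.
  by bits7.
have -> : F C = H C 'q_3 *m H C 'q_5 *m H C 'q_6 *m
    (CNOT C 'q_6 'q_1 *m CNOT C 'q_5 'q_2 *m CNOT C 'q_3 'q_4) *m H C 'q_7.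
  by rewrite /F !mulmxA.
rewrite cnotsE -mulmxA HC mulmxA.
congr (_ *m _); rewrite !mul_tensor; apply: op_of_ext => w v.
apply: eq_bigr => i _; rewrite !inE.
by do 4?[case: eqP => [->|_] /=; rewrite ?(mul1mx, mulmx1) //].
Qed.

Lemma F_unit : F C \in unitmx.
Proof.
rewrite FE unitmx_mul; apply/andP; split.
  by have /mulmx1_unit[] := tensor_hadamard_sqr C (mem [:: 'q_3; 'q_5; 'q_6; 'q_7]).
have /mulmx1_unit[] // : op_of_map C cnots *m op_of_map C cnots = 1%:M.
rewrite mul_op_of_map -monomial_id1 op_of_mapE.
by apply: monomial_ext => // v /=; rewrite cnotsK.
Qed.

Definition G_phase (a : bits 7) : 'F_2 :=
  a 0 'q_1 * a 0 'q_2 * a 0 'q_3 + a 0 'q_1 * a 0 'q_4 * a 0 'q_5 +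
  a 0 'q_2 * a 0 'q_4 * a 0 'q_6 + a 0 'q_3 * a 0 'q_5 * a 0 'q_6.

(** The polynomial form of a controlled swap: adding a_j + a_k to both bits exchanges them. It makes
    [G] accessible to [F2_ring]. *)
Lemma CSWAPE n (i j k : 'I_n) :
  CSWAP C i j k = op_of_map C (fun a =>
    set_bit (set_bit a j (a 0 j + a 0 i * (a 0 j + a 0 k)))
      k (a 0 k + a 0 i * (a 0 j + a 0 k))).
Proof.
rewrite /CSWAP !op_of_mapE; apply: monomial_ext => // a.
case: (F2P (a 0 i)) => -> /=.
  by apply/rowP => l; rewrite !mul0r !addr0 !mxE; do 2![case: eqP => [->|_] //].
congr set_bit; last by F2_ring.
by congr set_bit; F2_ring.
Qed.

Lemma CCZE n (i j k : 'I_n) :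
  CCZ C i j k = monomial id (fun v => sgn C (v 0 i * v 0 j * v 0 k)).
Proof. by []. Qed.

Lemma GE : G C = monomial G_map (fun v => sgn C (G_phase v)).
Proof.
rewrite /G !CSWAPE !mul_op_of_map op_of_mapE !CCZE !mul_monomial.
apply: monomial_ext => v /=; last by rewrite mul1r -!sgnD.
by bits7.
Qed.

Lemma hadamards_entry (w v : bits 7) :
  \prod_i (if i \in [:: 'q_3; 'q_5; 'q_6; 'q_7] then hadamard C else 1%:M)
            (w 0 i) (v 0 i) =
  (w 0 'q_1 == v 0 'q_1)%:R * (w 0 'q_2 == v 0 'q_2)%:R * (w 0 'q_4 == v 0 'q_4)%:R *
  ((sqrtC 2)^-1 ^+ 4 * sgn C (w 0 'q_3 * v 0 'q_3 + w 0 'q_5 * v 0 'q_5 +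
     w 0 'q_6 * v 0 'q_6 + w 0 'q_7 * v 0 'q_7)).
Proof.
set r := (sqrtC 2)^-1.
have rD f k a b : f * (r ^+ k * a) * (r * b) = f * (r ^+ k.+1 * (a * b)).
  by rewrite -mulrA mulrACA -exprSr.
rewrite prod_ord7 /= !hadamardE !sgnD.
rewrite [_ * (_ * _) * 1%:M _ _]mulrAC.
rewrite -[X in _ * (X * sgn _ (w 0 'q_3 * _))]expr1 !rD.
by rewrite !mxE.
Qed.

Lemma F_mul_G : F C *m G C = U3 C *m F C.
Proof.
rewrite FE GE U3E op_of_mapE -mulmxA mul_monomial mul_op_of_monomial.
rewrite mulmxA (mul_op_of_map_op _ U3_mapK U3_invK) mul_op_of_monomial.
apply: op_of_ext => w v; rewrite !hadamards_entry mul1r mulr1.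
(* A swap preserves the sum of the two bits it exchanges, so on qubits 1, 2, 4, which carry no
   Hadamard, both sides impose the same conditions on [w]. *)
have -> : cnots (G_map v) 0 'q_1 = v 0 'q_1 + v 0 'q_6 by bits_ring.
have -> : cnots (G_map v) 0 'q_2 = v 0 'q_2 + v 0 'q_5 by bits_ring.
have -> : cnots (G_map v) 0 'q_4 = v 0 'q_4 + v 0 'q_3 by bits_ring.
have -> : cnots v 0 'q_1 = v 0 'q_1 + v 0 'q_6 by bits_ring.
have -> : cnots v 0 'q_2 = v 0 'q_2 + v 0 'q_5 by bits_ring.
have -> : cnots v 0 'q_4 = v 0 'q_4 + v 0 'q_3 by bits_ring.
have -> : U3_inv w 0 'q_1 = w 0 'q_1 by bits_ring.
have -> : U3_inv w 0 'q_2 = w 0 'q_2 by bits_ring.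
have -> : U3_inv w 0 'q_4 = w 0 'q_4 by bits_ring.
case: eqP => [w1|_]; last by rewrite !mul0r.
case: eqP => [w2|_]; last by rewrite !(mulr0, mul0r).
case: eqP => [w4|_]; last by rewrite !(mulr0, mul0r).
have -> : w = row7 (v 0 'q_1 + v 0 'q_6) (v 0 'q_2 + v 0 'q_5) (w 0 'q_3)
    (v 0 'q_4 + v 0 'q_3) (w 0 'q_5) (w 0 'q_6) (w 0 'q_7).
  by apply: eq_bits7; rewrite ?w1 ?w2 ?w4; F2_ring.
(* Only the sign exponents remain. With w1 = v1 + v6, w2 = v2 + v5, w4 = v4 + v3, the polynomial w1
   w2 v3 + w1 w4 v5 + w2 w4 v6 from [U3_inv] expands to [G_phase v], and the terms containing v7
   match the swaps. *)
rewrite -!mulrA -sgnD; do 7!congr (_ * _); congr (sgn C _).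
by rewrite /G_phase /comp; bits_ring.
Qed.

End Conjugation.

Theorem proposition5p8 (R : realType) :
  [/\ permutation_gate (U3 R[i]),
      clifford_hierarchy 3 (U3 R[i]),
      ~ semi_clifford (U3 R[i])
    & F R[i] *m G R[i] *m invmx (F R[i]) = U3 R[i]].
Proof.
split; [exact: U3_permutation_gate | exact: U3_third_level
       | exact: U3_not_semi_clifford | by rewrite F_mul_G mulmxK ?F_unit].
Qed.
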